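(* For every integer $n\ge 1$ and every $\delta>0$ there is a constant $C_{\delta,n}$, depending only on $\delta$ and $n$ (and in particular not on the metric space $\mathcal{M}$ or on the function $f$ below), such that the following holds. Let $(\mathcal{M},\mathrm{dist})$ be a metric space and let $f:\mathbb{R}^n\to\mathcal{M}$ be an $L$-Lipschitz function. Then for each dyadic cube $R\in\Delta(\mathbb{R}^n)$, $$\sum\{\mathrm{vol}(Q) : Q\in\Delta(R),\ \mathrm{md}(3Q)>\delta L\}\ \le\ C_{\delta,n}\cdot \mathrm{vol}(R).$$
   Context: $\Delta(\mathbb{R}^n)$ is the collection of dyadic cubes in $\mathbb{R}^n$ (cubes $\prod_{i=1}^n[j_i2^{k},(j_i+1)2^{k})$ with $k,j_1,\dots,j_n\in\mathbb{Z}$), and for $R\in\Delta(\mathbb{R}^n)$, $\Delta(R)=\{Q\in\Delta(\mathbb{R}^n): Q\subset R\}$. For a cube $Q$, $\mathrm{side}(Q)$ is its sidelength, $\mathrm{vol}(Q)$ its $n$-dimensional Lebesgue measure, and $3Q$ is the cube with the same center as $Q$ (and sides parallel to those of $Q$) but 3 times the sidelength. The function $f$ is $L$-Lipschitz if $\mathrm{dist}(f(x),f(y))\le L|x-y|$ for all $x,y\in\mathbb{R}^n$, where $|x-y|$ is the Euclidean distance. For a cube $Q\subset\mathbb{R}^n$ define $$\mathrm{md}(Q)=\frac{1}{\mathrm{side}(Q)}\inf_{\|\cdot\|}\ \sup_{x,y\in Q}\Big|\,\mathrm{dist}(f(x),f(y))-\|x-y\|\,\Big|,$$ where the infimum is over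 all seminorms $\|\cdot\|$ on $\mathbb{R}^n$. *)

(* Defs.v *)
From mathcomp Require Import all_boot all_order all_algebra.
From mathcomp Require Import all_classical all_reals all_analysis.

Set Implicit Arguments.
Unset Strict Implicit.
Unset Printing Implicit Defensive.

Import Order.TTheory GRing.Theory Num.Theory.
Import numFieldNormedType.Exports.

Local Open Scope classical_set_scope.
Local Open Scope ring_scope.

(* The norm that the library puts on ['rV[R]_n] is the sup norm. *)
Definition enorm (R : realType) (n : nat) (x : 'rV[R]_n) : R :=
  Num.sqrt (\sum_(i < n) x 0 i ^+ 2).

Definition is_seminorm (R : realType) (n : nat) (N : 'rV[R]_n -> R) : Prop :=
  [/\ forall x, 0 <= N x,
      forall (a : R) x, N (a *: x) = `|a| * N x &
      forall x y, N (x + y) <= N x + N y].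

Definition is_Lipschitz (R : realType) (n : nat) (M : metricType R)
    (L : R) (f : 'rV[R]_n -> M) : Prop :=
  forall x y, mdist (f x) (f y) <= L * enorm (x - y).

(* Iterated product of the one-dimensional Lebesgue measure, computed by
   sections as in the library's binary product [\x]; it is meaningful on
   Borel sets, in particular on cubes. *)
Fixpoint lebesgue_measure_rV (R : realType) (n : nat) :
    set 'rV[R]_n -> \bar R :=
  match n return set 'rV[R]_n -> \bar R with
  | 0 => fun A => (\1_A 0)%:E
  | m.+1 => fun A =>
      (\int[@lebesgue_measure R]_t
         lebesgue_measure_rV
           [set y : 'rV[R]_m | A (row_mx (t%:M : 'rV[R]_1) y)])%E
  end.

(* A cube is given by its lower corner and its sidelength (meant to be
   positive).  All cubes are half-open, including the dilates [3Q]. *)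
Definition cube (R : realType) (n : nat) : Type := ('rV[R]_n * R)%type.

Section Cubes.
Context {R : realType} {n : nat}.
Implicit Type Q : cube R n.

Definition corner Q : 'rV[R]_n := Q.1.

Definition side Q : R := Q.2.

Definition points Q : set 'rV[R]_n :=
  [set x | forall i, corner Q 0 i <= x 0 i < corner Q 0 i + side Q].

Definition center Q : 'rV[R]_n := \row_i (corner Q 0 i + side Q / 2).

Definition cube_of_center (c : 'rV[R]_n) (s : R) : cube R n :=
  (\row_i (c 0 i - s / 2), s).

Definition triple Q : cube R n := cube_of_center (center Q) (3 * side Q).

Definition vol Q : \bar R := lebesgue_measure_rV (points Q).

Definition dyadic : set (cube R n) :=
  [set Q | exists (k : int) (j : 'I_n -> int),
     Q = (\row_i ((j i)%:~R * 2 ^ k), 2 ^ k)].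

Definition dyadic_in Q0 : set (cube R n) :=
  [set Q | dyadic Q /\ points Q `<=` points Q0].

Definition md (M : metricType R) (f : 'rV[R]_n -> M) Q : \bar R :=
  ((side Q)^-1%:E *
   ereal_inf [set ereal_sup [set `|mdist (f x) (f y) - N (x - y)|%:E
                               | x in points Q & y in points Q]
                | N in [set N | is_seminorm N]])%E.

End Cubes.

(* Main.v *)
Require Import Defs.
From mathcomp Require Import all_boot all_order all_algebra.
From mathcomp Require Import all_classical all_reals all_analysis.
From mathcomp Require Import measurable_realfun.
From mathcomp Require Import zify ring lra.

(** Write [dist (f x, f y) = L n D (x, y)]: then [D] is a pseudometric bounded by
    the sup norm, and the claim is a Carleson packing bound for the cubes on
    which [D] is far from every seminorm.  It follows from two facts.

    The first is geometric ([straight_near_seminorm], [finite_test]).  On a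
    normalized cube, take a long vector [v] and a large [M], and call the segment
    from [y] to [y + v] straight if each of its [M] equal pieces has [D]-length at
    most [(D (y, y + v) + eps) / M].  Along straight segments [D] is almost
    homogeneous.  It is also almost translation invariant: moving the base point
    by [a] changes [D (y, y + v)] by at most [2 |a|], which is negligible once
    divided by the length of [v].  Hence, if the segments in finitely many
    directions are straight at all base points [y] near the cube, then [D] is
    uniformly close to the seminorm generated by its values in those directions.
    The exact seminorm is the gauge
      [N v = inf_t sum_p |t_p| (h_p + e) + |v - sum_p t_p u_p|],
    where [u] is a finite net and [h_p] the [D]-speed in direction [u_p].  The
    surcharge [e] makes decompositions with large coefficients too expensive to
    matter, so that only boundedly long paths have to be compared with [D].

    The second is a monotonicity ([energy_step], [total_deviation_le]).  Fix a
    lattice vector [v] and let [c_j (y) = D (y, y + 2^j v) / 2^j].  By the triangle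
    inequality [c_(j+m) (y)] is at most the mean of the [2^m] numbers
    [a_i = c_j (y + i 2^j v)], so
      [c_(j+m)^2 + mean (a_i - c_(j+m))^2 <= mean a_i^2].
    Summed over [y], the mean square of [c_j] can only increase as the scale
    decreases; being bounded, it telescopes, and the sum over all scales of the
    mean square deviations is at most a constant times the volume of the
    big cube.

    A cube far from every seminorm violates straightness for some direction, some
    piece and some base point; by Lipschitz continuity the violation persists on a
    subcube whose volume is a fixed fraction of that of the cube
    ([defect_slope]).  There the square deviation is bounded below, so for each of
    the finitely many kinds of violation the volumes of the offending cubes are
    controlled by the telescoped energy ([cell_packing], [lattice_packing]).

    All sums are taken over a lattice finer than every cube of a given finite
    family, which avoids any measurability question; the constants do not depend
    on the lattice, so they pass to the supremum over finite families. *)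

Import Order.TTheory GRing.Theory Num.Theory.
Import numFieldNormedType.Exports.

Local Open Scope classical_set_scope.
Local Open Scope ring_scope.

Set Implicit Arguments.
Unset Strict Implicit.
Unset Printing Implicit Defensive.

(** * Finite sums *)

(** The only form of change of variables used below: it covers both translations
    of lattice regions and the disjointness of the cells of distinct cubes. *)
Lemma ler_sum_seq_inj (R : numDomainType) (T U : eqType) (s : seq T) (s' : seq U)
    (h : T -> U) (F : U -> R) :
  uniq s -> uniq s' -> {in s &, injective h} ->
  (forall x, x \in s -> h x \in s') -> (forall y, 0 <= F y) ->
  \sum_(x <- s) F (h x) <= \sum_(y <- s') F y.
Proof.
move=> us us' inj sub F0.
rewrite -(big_map h xpredT F) [leRHS](bigID (fun y => y \in map h s)) /=.
have E : perm_eq [seq i <- s' | i \in map h s] (map h s).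
  apply: uniq_perm; [exact: filter_uniq|by rewrite map_inj_in_uniq|].
  move=> y; rewrite mem_filter andb_idr// => /mapP[x xs ->]; exact: sub.
by rewrite -(perm_big _ E) big_filter lerDl sumr_ge0.
Qed.

Lemma sum_le_cover (R : numDomainType) (T K : eqType) (X : seq T) (Ks : seq K)
    (bad : K -> pred T) (w : T -> R) (B : R) :
  (forall t, 0 <= w t) ->
  (forall t, t \in X -> exists2 k, k \in Ks & bad k t) ->
  (forall k, k \in Ks -> \sum_(t <- X | bad k t) w t <= B) ->
  \sum_(t <- X) w t <= (size Ks)%:R * B.
Proof.
move=> w0 cov wB; apply: (@le_trans _ _ (\sum_(k <- Ks) \sum_(t <- X | bad k t) w t)).
  under [leRHS]eq_bigr do rewrite big_mkcond; rewrite exchange_big /=.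
  rewrite big_seq [leRHS]big_seq; apply: ler_sum => t /cov[k kK bk].
  rewrite (big_rem k)//= bk lerDl; apply: sumr_ge0 => k' _; by case: ifP.
rewrite mulr_natl -[size Ks]count_predT -iter_addr_0 -big_const_seq.
by rewrite big_seq [leRHS]big_seq; apply: ler_sum => k /wB.
Qed.

(** * Norms and volumes *)

Lemma rV_norm_le (R : realType) n (x : 'rV[R]_n) r :
  0 <= r -> (`|x| <= r) <-> (forall i, `|x 0 i| <= r).
Proof.
move=> r0; split=> [xr i|H].
  apply: le_trans xr; rewrite [leRHS]mx_normrE.
  by rewrite (le_bigmax _ _ (0, i)).
rewrite [leLHS]mx_normrE; apply: bigmax_le => // -[i j] _ /=; rewrite (ord1 i); exact: H.
Qed.

Lemma enorm_le (R : realType) n (x : 'rV[R]_n) : enorm x <= n%:R * `|x|.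
Proof.
rewrite -(ger0_norm (mulr_ge0 (ler0n R n) (normr_ge0 x))) -sqrtr_sqr ler_sqrt ?sqr_ge0//.
apply: (@le_trans _ _ (n%:R * `|x| ^+ 2)).
  have <- : \sum_(i < n) `|x| ^+ 2 = n%:R * `|x| ^+ 2 by rewrite sumr_const card_ord mulr_natl.
  apply: ler_sum => i _.
  rewrite -[x 0 i ^+ 2]real_normK ?num_real// lerXn2r ?nnegrE//.
  by apply: (rV_norm_le x (normr_ge0 x)).1.
rewrite exprMn ler_wpM2r ?sqr_ge0// -natrX ler_nat.
by case: (n) => // k; rewrite expnS leq_pmulr.
Qed.

Lemma lebesgue_measure_rV_set0 (R : realType) n :
  lebesgue_measure_rV (set0 : set 'rV[R]_n) = 0%E.
Proof.
elim: n => [|n IH] /=; first by rewrite indicE in_set0.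
by under eq_integral do rewrite (_ : [set y | _] = set0) ?IH//; rewrite integral0.
Qed.

(** Each section of a cube is a cube of one dimension less or empty, so the iterated
    integral is computed by induction. *)
Lemma volE (R : realType) n (Q : cube R n) : 0 <= side Q -> vol Q = (side Q ^+ n)%:E.
Proof.
move=> s0; rewrite /vol; elim: n Q s0 => [|n IH] Q s0 /=.
  by rewrite indicE mem_set// => -[].
pose c0 := corner Q 0 ord0; pose Q' : cube R n := (\row_i corner Q 0 (lift ord0 i), side Q).
have E t : [set y : 'rV[R]_n | points Q (row_mx (t%:M : 'rV[R]_1) y)] =
    if t \in (`[c0, c0 + side Q[)%classic then points Q' else set0.
  have P0 y : (row_mx (t%:M : 'rV[R]_1) y : 'rV[R]_(1 + n)) 0 ord0 = t.
    have -> : ord0 = lshift n ord0 :> 'I_(1 + n) by exact/val_inj.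
    by rewrite row_mxEl mxE.
  have PS y i : (row_mx (t%:M : 'rV[R]_1) y : 'rV[R]_(1 + n)) 0 (lift ord0 i) = y 0 i.
    have -> : lift ord0 i = rshift 1 i :> 'I_(1 + n) by exact/val_inj.
    by rewrite row_mxEr.
  apply/seteqP; split => y /=.
    move=> H; rewrite mem_set /=; last by have := H ord0; rewrite P0 in_itv.
    by move=> i; have := H (lift ord0 i); rewrite PS !mxE.
  case: ifPn => // /set_mem/=; rewrite in_itv /= => t0 H i.
  case: (unliftP ord0 i) => [j ->|->]; last by rewrite P0.
  by rewrite PS; have := H j; rewrite !mxE.
transitivity (\int[lebesgue_measure]_t ((side Q ^+ n) * \1_(`[c0, c0 + side Q[)%classic t)%:E)%E.
  apply: eq_integral => t _; rewrite E indicE.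
  by case: ifP => _; [rewrite (IH Q')// mulr1|rewrite lebesgue_measure_rV_set0 mulr0].
under eq_integral do rewrite EFinM.
rewrite ge0_integralZl_EFin ?exprn_ge0//; last first.
  by apply/measurable_EFinP; exact: measurable_indic.
rewrite integral_indic// setIT.
rewrite [X in (_ * X)%E](lebesgue_measure_itv `[c0, c0 + side Q[) /= lte_fin.
case: ltP; rewrite -?EFinD -EFinM exprSr; first by rewrite addrAC subrr add0r.
by rewrite gerDl => h; have -> : side Q = 0 by apply/eqP; rewrite eq_le h.
Qed.

(** * Pseudometrics dominated by the sup norm *)

Definition short_pseudometric (R : realType) n (D : 'rV[R]_n -> 'rV[R]_n -> R) : Prop :=
  [/\ forall x y, 0 <= D x y, forall x y, D x y = D y x,
      forall x y z, D x z <= D x y + D y z & forall x y, D x y <= `|x - y|].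

Section Short.
Context {R : realType} {n : nat} {D : 'rV[R]_n -> 'rV[R]_n -> R}.
Hypothesis sD : short_pseudometric D.

Lemma short_refl x : D x x = 0.
Proof.
by case: sD => D0 _ _ D1; apply/eqP; rewrite eq_le D0 andbT; have := D1 x x; rewrite subrr normr0.
Qed.

(** This is what lets a test made at one base point stand for all nearby ones. *)
Lemma short_perturb x y x' y' : D x y <= D x' y' + `|x - x'| + `|y - y'|.
Proof.
case: sD => D0 Ds Dt D1.
have := Dt x x' y; have := Dt x' y' y; have := D1 x x'; have := D1 y' y.
rewrite (distrC y'); lra.
Qed.

Lemma short_path (c : nat -> 'rV[R]_n) k :
  D (c 0%N) (c k) <= \sum_(i < k) D (c i) (c i.+1).
Proof.
case: sD => D0 Ds Dt D1; elim: k => [|k IH]; first by rewrite short_refl big_ord0.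
by rewrite big_ord_recr /=; apply: le_trans (Dt _ (c k) _) _; rewrite lerD2r.
Qed.

Lemma short_path_sum (I : Type) (s : seq I) (w : I -> 'rV[R]_n) (B : I -> R) r x :
  (forall p y, `|y| <= r -> D y (y + w p) <= B p) ->
  `|x| + \sum_(p <- s) `|w p| <= r ->
  D x (x + \sum_(p <- s) w p) <= \sum_(p <- s) B p.
Proof.
move=> wB; case: sD => _ _ Dt _.
elim: s x => [|p s IH] x; rewrite ?big_nil ?addr0 ?short_refl// !big_cons => xr.
have w0 : 0 <= \sum_(q <- s) `|w q| by exact: sumr_ge0.
apply: le_trans (Dt _ (x + w p) _) _; apply: lerD.
  by apply: wB; have := normr_ge0 (w p); lra.
by rewrite addrA; apply: IH; have := ler_normD x (w p); lra.
Qed.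

End Short.

(** The bounds 2 and 3 are those satisfied by points of the triple of the unit cube
    [[0, 1)^n] and by their differences. *)
Definition near_seminorm (R : realType) n (delta : R) (D : 'rV[R]_n -> 'rV[R]_n -> R) : Prop :=
  exists2 N, is_seminorm N &
    forall x y, `|x| <= 2 -> `|y| <= 2 -> `|x - y| <= 3 -> `|D x y - N (x - y)| <= delta.

Definition rescale (R : realType) n (a : 'rV[R]_n) (s : R) (D : 'rV[R]_n -> 'rV[R]_n -> R) :=
  fun x y => s^-1 * D (a + s *: x) (a + s *: y).

Lemma short_rescale (R : realType) n (a : 'rV[R]_n) s D :
  0 < s -> short_pseudometric D -> short_pseudometric (rescale a s D).
Proof.
move=> s0 [D0 Ds Dt D1]; split=> [x y|x y|x y z|x y]; rewrite /rescale.
- by rewrite mulr_ge0// invr_ge0 ltW.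
- by rewrite Ds.
- by rewrite -mulrDr ler_wpM2l// invr_ge0 ltW.
- rewrite ler_pdivrMl//; apply: le_trans (D1 _ _) _.
  by rewrite opprD addrACA subrr add0r -scalerBr normrZ gtr0_norm.
Qed.

Lemma rescale_rescale (R : realType) n (a b : 'rV[R]_n) s t D :
  rescale a s (rescale b t D) = rescale (b + t *: a) (t * s) D.
Proof.
apply/funext => x; apply/funext => y.
by rewrite /rescale invfM mulrCA mulrA !scalerDr !addrA !scalerA.
Qed.

(** * Seminorms as infimal costs *)

(** [Phi] is a seminorm on the product of the two spaces; minimizing over the second
    variable yields the quotient seminorm on the first. *)
Lemma quotient_seminorm (R : realType) n (W : lmodType R) (Phi : 'rV[R]_n -> W -> R) :
  (forall v t, 0 <= Phi v t) ->
  (forall a v t, Phi (a *: v) (a *: t) = `|a| * Phi v t) ->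
  (forall v v' t t', Phi (v + v') (t + t') <= Phi v t + Phi v' t') ->
  is_seminorm (fun v => inf [set Phi v t | t in setT]).
Proof.
move=> P0 PZ PD.
have ne v : [set Phi v t | t in setT] !=set0 by exists (Phi v 0), 0.
have lb v : has_lbound [set Phi v t | t in setT] by exists 0 => _ [t _ <-].
have N0 v : 0 <= inf [set Phi v t | t in setT].
  by apply: lb_le_inf => // _ [t _ <-].
have NZ a v : inf [set Phi (a *: v) t | t in setT] <= `|a| * inf [set Phi v t | t in setT].
  have [->|a0] := eqVneq a 0.
    rewrite normr0 mul0r ge_inf//; exists 0 => //.
    by have := PZ 0 v 0; rewrite scaler0 normr0 mul0r.
  rewrite -ler_pdivrMl ?normr_gt0//; apply: lb_le_inf => // _ [t _ <-].
  rewrite ler_pdivrMl ?normr_gt0// -PZ; apply: ge_inf => //; by exists (a *: t).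
split=> //.
- move=> a x; apply/eqP; rewrite eq_le NZ /=; have [->|a0] := eqVneq a 0.
    by rewrite normr0 mul0r.
  rewrite -ler_pdivlMl ?normr_gt0// -normfV.
  by apply: le_trans (NZ _ _); rewrite scalerA mulVf// scale1r.
- move=> x y; rewrite -lerBlDr; apply: lb_le_inf => // _ [t _ <-].
  rewrite lerBlDr [leRHS]addrC -lerBlDr; apply: lb_le_inf => // _ [t' _ <-].
  rewrite lerBlDr [leRHS]addrC; apply: le_trans (PD _ _ _ _).
  by apply: ge_inf => //; exists (t + t').
Qed.

(** The last term allows decompositions of [v] that are only approximate; thus the
    vectors [u p] need not span. *)
Definition gauge_cost (R : realType) n (I : finType) (u : I -> 'rV[R]_n) (wt : I -> R)
    (v : 'rV[R]_n) (t : {ffun I -> R^o}) : R :=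
  \sum_p `|t p| * wt p + `|v - \sum_p t p *: u p|.

Definition gauge (R : realType) n (I : finType) (u : I -> 'rV[R]_n) (wt : I -> R)
    (v : 'rV[R]_n) : R :=
  inf [set gauge_cost u wt v t | t in setT].

Lemma gauge_cost_ge0 (R : realType) n (I : finType) (u : I -> 'rV[R]_n) (wt : I -> R) v t :
  (forall p, 0 <= wt p) -> 0 <= gauge_cost u wt v t.
Proof.
by move=> wt0; apply: addr_ge0 => //; apply: sumr_ge0 => p _; rewrite mulr_ge0.
Qed.

Lemma gauge_seminorm (R : realType) n (I : finType) (u : I -> 'rV[R]_n) (wt : I -> R) :
  (forall p, 0 <= wt p) -> is_seminorm (gauge u wt).
Proof.
move=> wt0; apply: quotient_seminorm => [v t|a v t|v v' t t'].
- exact: gauge_cost_ge0.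
- have -> : gauge_cost u wt (a *: v) (a *: t) = \sum_p `|a| * (`|t p| * wt p) +
      `|a *: v - a *: \sum_p t p *: u p|.
    rewrite /gauge_cost scaler_sumr; congr (_ + _).
      by apply: eq_bigr => p _; rewrite ffunE normrM mulrA.
    by congr (`|_ - _|); apply: eq_bigr => p _; rewrite ffunE scalerA.
  by rewrite -mulr_sumr -scalerBr normrZ -mulrDr.
- rewrite /gauge_cost addrACA -big_split; apply: lerD.
    by apply: ler_sum => p _; rewrite /= ffunE -mulrDl ler_wpM2r// ler_normD.
  have -> : \sum_p (t + t') p *: u p = \sum_p t p *: u p + \sum_p t' p *: u p.
    by rewrite -big_split; apply: eq_bigr => p _; rewrite ffunE scalerDl.
  by rewrite opprD addrACA ler_normD.
Qed.

(** * Straight segments force closeness to a seminorm *)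

(** Only an upper bound on the pieces is asked for: by the triangle inequality their
    mean cannot be smaller than [D y (y + v) / M]. *)
Definition straight (R : realType) n (D : 'rV[R]_n -> 'rV[R]_n -> R) (M : nat)
    (eps : R) (y v : 'rV[R]_n) : Prop :=
  forall i, (i < M)%N ->
    M%:R * D (y + (i%:R / M%:R) *: v) (y + (i.+1%:R / M%:R) *: v)
      <= D y (y + v) + eps.

Section Straight.
Context {R : realType} {n : nat} {D : 'rV[R]_n -> 'rV[R]_n -> R}.
Hypothesis sD : short_pseudometric D.

Lemma straight_sub M eps y v a k : straight D M eps y v -> (a + k <= M)%N ->
  D (y + (a%:R / M%:R) *: v) (y + ((a + k)%:R / M%:R) *: v)
    <= k%:R / M%:R * (D y (y + v) + eps).
Proof.
move=> sv akM; have [->|k0] := posnP k.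
  by rewrite addn0 (short_refl sD) !mul0r.
have M0 : (0 : R) < M%:R by rewrite ltr0n; lia.
pose c i := y + ((a + i)%N%:R / M%:R) *: v.
have := short_path sD c k; rewrite /c addn0 => /le_trans; apply.
apply: (@le_trans _ _ (\sum_(i < k) (D y (y + v) + eps) / M%:R)).
  apply: ler_sum => i _; rewrite ler_pdivlMr// mulrC addnS; apply: sv.
  by have := ltn_ord i; lia.
by rewrite sumr_const card_ord -[leLHS]mulr_natl mulrA mulrAC.
Qed.

(** Upper half of homogeneity.  The multiple [t] is rounded down to one of the
    subdivision points [m / k], which costs [|u| / k]. *)
Lemma straight_prefix S k eps y u t :
  (0 < S)%N -> (0 < k)%N -> 0 <= eps -> straight D (S * k) eps y (S%:R *: u) ->
  0 <= t -> t <= S%:R ->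
  D y (y + t *: u) <= t / S%:R * D y (y + S%:R *: u) + eps + `|u| / k%:R.
Proof.
move=> S0 k0 e0 sv t0 tS; case: sD => D0 _ _ _.
have S0' : (0 : R) < S%:R by rewrite ltr0n.
have k0' : (0 : R) < k%:R by rewrite ltr0n.
set m := Num.truncn (t * k%:R); have /andP[m1 m2] : m%:R <= t * k%:R < m.+1%:R.
  by apply: truncn_itv; rewrite mulr_ge0.
have mM : (m <= S * k)%N.
  rewrite -(ler_nat R) natrM; apply: le_trans m1 _; by rewrite ler_wpM2r// ltW.
have := straight_sub (a := 0) (k := m) sv mM; rewrite add0n mul0r scale0r addr0.
rewrite scalerA => H.
apply: le_trans (short_perturb sD _ _ y (y + (m%:R / (S * k)%:R * S%:R) *: u)) _.
rewrite subrr normr0 addr0; apply: lerD.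
  apply: le_trans H _; rewrite mulrDr; apply: lerD.
    rewrite ler_wpM2r// ler_pdivrMr ?natrM ?mulr_gt0//.
    by rewrite mulrA divfK ?gt_eqF.
  apply: ler_piMl => //; rewrite ler_pdivrMr ?mul1r ?ler_nat//.
  by rewrite ltr0n muln_gt0 S0.
rewrite opprD addrACA subrr add0r -scalerBl normrZ mulrC ler_wpM2l//.
have -> : m%:R / (S * k)%:R * S%:R = m%:R / k%:R :> R.
  by rewrite natrM; field; rewrite !gt_eqF.
have h1 : m%:R / k%:R <= t by rewrite ler_pdivrMr.
have h2 : t <= m%:R / k%:R + k%:R^-1.
  by rewrite -[X in _ + X]mul1r -mulrDl natr1 ler_pdivlMr// ltW.
have : (0 : R) < k%:R^-1 by rewrite invr_gt0.
by rewrite ler_norml; move: h1 h2; lra.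
Qed.

(** Lower half of homogeneity.  The last [S * k - k] of the pieces of the segment
    cannot be longer than their share, so the first [k] of them, which make up the
    segment from [y] to [y + u], cannot be much shorter than theirs. *)
Lemma straight_mean S k eps y u :
  (0 < S)%N -> (0 < k)%N -> 0 <= eps -> straight D (S * k) eps y (S%:R *: u) ->
  D y (y + S%:R *: u) / S%:R <= D y (y + u) + eps.
Proof.
move=> S0 k0 e0 sv; case: sD => D0 _ Dt _.
have S0' : (0 : R) < S%:R by rewrite ltr0n.
have k0' : (0 : R) < k%:R by rewrite ltr0n.
have := straight_sub (a := k) (k := S * k - k) sv.
have kS : (k <= S * k)%N by rewrite leq_pmull.
rewrite subnKC// => /(_ (leqnn _)).
rewrite natrM divff ?mulf_neq0 ?gt_eqF// scale1r natrB// natrM scalerA.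
have -> : k%:R / (S%:R * k%:R) * S%:R = 1 :> R by field; rewrite !gt_eqF.
rewrite scale1r; have := Dt y (y + u) (y + S%:R *: u).
set X := D y (y + S%:R *: u); set Z := D _ (y + _).
have -> : (S%:R * k%:R - k%:R) / (S%:R * k%:R) = 1 - S%:R^-1 :> R.
  by field; rewrite !gt_eqF.
have : 0 <= eps / S%:R by rewrite divr_ge0// ltW.
rewrite mulrBl mul1r mulrDr ![S%:R^-1 * _]mulrC; lra.
Qed.

(** With [h p] the speed of [D] over the long segment from the origin in direction
    [u p], the seminorm is the gauge of the weights [h p + e].
    It is not much above [D]: approximate [y - x] by some [u p] and use
    [straight_mean].  It is not much below: a decomposition of [y - x] whose
    coefficients add up to [T = 3 / e] or more costs at least 3, which is at
    least [D x y]; the others describe paths that stay in a fixed ball, along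
    which [straight_prefix] bounds [D] leg by leg.  The total error of the legs is
    bounded by the last hypothesis, where [18 / e = 6 T] bounds how far the paths wander. *)
Lemma straight_near_seminorm (I : finType) (u : I -> 'rV[R]_n) (S k : nat)
    (e eps delta : R) :
  0 < e -> 0 <= eps -> (0 < S)%N -> (0 < k)%N ->
  (forall p, `|u p| <= 3) ->
  (forall v, `|v| <= 3 -> exists p, `|v - u p| <= e) ->
  3 / e <= S%:R ->
  (forall p y, `|y| <= 2 + 18 / e -> straight D (S * k) eps y (S%:R *: u p)) ->
  3 * e + eps + 4 / S%:R <= delta ->
  #|I|%:R * (3 / e * (2 * (2 + 18 / e)) / S%:R + eps + 3 / k%:R) <= delta ->
  near_seminorm delta D.
Proof.
move=> e0 eps0 S0 k0 u3 net TS st d1 d2; case: (sD) => D0 Ds Dt D1.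
have S0' : (0 : R) < S%:R by rewrite ltr0n.
have k0' : (0 : R) < k%:R by rewrite ltr0n.
set T := 3 / e in TS d2 *; have T0 : 0 < T by rewrite divr_gt0.
have ET : 18 / e = 6 * T by rewrite /T; field; rewrite gt_eqF.
rewrite ET in st d2 *.
pose h p := D 0 (S%:R *: u p) / S%:R.
have h0 p : 0 <= h p by rewrite divr_ge0// ltW.
(* The same speed is seen from every base point of the ball, up to an error that
   dividing by [S] makes small. *)
have hD p y : `|S%:R * h p - D y (y + S%:R *: u p)| <= 2 * `|y|.
  have -> : S%:R * h p = D 0 (0 + S%:R *: u p) by rewrite add0r /h mulrC divfK// gt_eqF.
  have := short_perturb sD 0 (0 + S%:R *: u p) y (y + S%:R *: u p).
  have := short_perturb sD y (y + S%:R *: u p) 0 (0 + S%:R *: u p).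
  rewrite add0r addrK subr0 sub0r normrN opprD addrCA subrr addr0 normrN ler_norml; lra.
set eta := T * (2 * (2 + 6 * T)) / S%:R + eps + 3 / k%:R in d2 *.
have step0 p t y : `|y| <= 2 + 6 * T -> 0 <= t -> t <= T ->
    D y (y + t *: u p) <= t * h p + eta.
  move=> yT t0 tT.
  apply: le_trans (straight_prefix S0 k0 eps0 (st _ _ yT) t0 (le_trans tT TS)) _.
  have H1 : t / S%:R * D y (y + S%:R *: u p) <= t * h p + T * (2 * (2 + 6 * T)) / S%:R.
    have -> : t * h p = t / S%:R * (S%:R * h p) by field; rewrite gt_eqF.
    have tS0 : 0 <= t / S%:R by rewrite divr_ge0// ltW.
    apply: (@le_trans _ _ (t / S%:R * (S%:R * h p + 2 * `|y|))).
      by rewrite ler_wpM2l//; have := hD p y; rewrite ler_norml; lra.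
    rewrite mulrDr lerD2l [leRHS]mulrAC; apply: ler_pM => //.
    - by rewrite ler_wpM2r// invr_ge0 ltW.
    - lra.
  have H2 : `|u p| / k%:R <= 3 / k%:R by rewrite ler_wpM2r// invr_ge0 ltW.
  rewrite /eta; lra.
(* For a negative coefficient the leg is traversed from its other end. *)
have step p t y : `|y| <= 2 + 3 * T -> `|t| <= T -> D y (y + t *: u p) <= `|t| * h p + eta.
  move=> yT; have [t0 tT|t0 tT] := ger0P t; first by apply: step0; lra.
  have yE : y = y + t *: u p + (- t) *: u p by rewrite -addrA -scalerDl subrr scale0r addr0.
  rewrite Ds {2}yE; apply: step0 => //; last by rewrite oppr_ge0 ltW.
  apply: le_trans (ler_normD _ _) _; rewrite normrZ ltr0_norm//.
  have t1 : 0 <= - t by rewrite oppr_ge0 ltW.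
  have := ler_pM t1 (normr_ge0 (u p)) tT (u3 p); lra.
have he0 p : 0 <= h p + e by rewrite addr_ge0// ltW.
have sN := gauge_seminorm u he0.
set N := gauge u (fun p => h p + e) in sN *; exists N => //.
have Neven v : N v = N (- v).
  by case: sN => _ NZ _; have := NZ (-1) v; rewrite scaleN1r normrN1 mul1r.
move=> x y x2 y2 xy3; rewrite Neven opprB.
suff [A B] : N (y - x) <= D x y + delta /\
    D x y <= N (y - x) + delta.
  by rewrite ler_norml; lra.
split.
  have [p pe] : exists p, `|y - x - u p| <= e by apply: net; rewrite distrC.
  apply: (@le_trans _ _ (gauge_cost u (fun p => h p + e) (y - x) [ffun q => (q == p)%:R])).
    apply: ge_inf; last by exists [ffun q => (q == p)%:R].
    by exists 0 => _ [t _ <-]; exact: gauge_cost_ge0.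
  rewrite /gauge_cost (bigD1 p)//= big1 => [|q /negPf qp]; last by rewrite ffunE qp normr0 mul0r.
  rewrite (bigD1 p)//= big1 => [|q /negPf qp]; last by rewrite ffunE qp scale0r.
  rewrite ffunE eqxx normr1 mul1r scale1r !addr0.
  have x6 : `|x| <= 2 + 6 * T by lra.
  have := straight_mean S0 k0 eps0 (st p x x6).
  have := short_perturb sD x (x + u p) x y.
  have -> : x + u p - y = - (y - x - u p) by rewrite !opprB addrA addrAC [RHS]addrC addrA.
  rewrite normrN subrr normr0.
  have : h p <= D x (x + S%:R *: u p) / S%:R + 4 / S%:R.
    rewrite -mulrDl ler_pdivlMr// mulrC.
    by have := hD p x; rewrite ler_norml; lra.
  lra.
rewrite -lerBlDr; apply: lb_le_inf => [|_ [t _ <-]]; 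
  first by exists (gauge_cost u (fun p => h p + e) (y - x) 0), 0.
rewrite lerBlDr.
have t0 : 0 <= \sum_p `|t p| * h p by apply: sumr_ge0 => p _; rewrite mulr_ge0.
have PhiE : gauge_cost u (fun p => h p + e) (y - x) t = \sum_p `|t p| * h p + (\sum_p `|t p|) * e +
    `|y - x - \sum_p t p *: u p|.
  rewrite /gauge_cost mulr_suml -big_split; congr (_ + _).
  by apply: eq_bigr => p _; rewrite mulrDr.
have delta0 : 0 <= delta.
  apply: le_trans d1; have : (0 : R) <= 4 / S%:R by rewrite divr_ge0// ltW.
  lra.
have := normr_ge0 (y - x - \sum_p t p *: u p); rewrite PhiE.
(* The surcharge [e] disposes of large coefficients. *)
have [tT|Tt] := leP (\sum_p `|t p|) T; last first.
  have : T * e <= (\sum_p `|t p|) * e by rewrite ler_wpM2r// ltW.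
  rewrite divfK ?gt_eqF//; have := D1 x y; lra.
have tl p : `|t p| <= T.
  by apply: le_trans tT; rewrite (bigD1 p)//= lerDl sumr_ge0.
have : D x (x + \sum_p t p *: u p) <= \sum_p (`|t p| * h p + eta).
  apply: (@short_path_sum _ _ _ sD _ _ _ _ (2 + 3 * T)) => [p z zT|]; first exact: step.
  apply: lerD => //; apply: (@le_trans _ _ (\sum_p 3 * `|t p|)).
    by apply: ler_sum => p _; rewrite normrZ mulrC ler_wpM2r.
  by rewrite -mulr_sumr ler_wpM2l.
rewrite big_split /= sumr_const -[eta *+ _]mulr_natl.
have := short_perturb sD x y x (x + \sum_p t p *: u p).
rewrite subrr normr0 opprD addrA.
have : 0 <= (\sum_p `|t p|) * e by rewrite mulr_ge0 ?sumr_ge0// ltW.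
lra.
Qed.
End Straight.

(** * Lattice points *)

Definition emb (R : realType) n (y : 'rV[int]_n) : 'rV[R]_n := map_mx intr y.

Lemma embD (R : realType) n (y z : 'rV[int]_n) : emb R (y + z) = emb R y + emb R z.
Proof. exact: map_mxD. Qed.

Lemma embMn (R : realType) n (y : 'rV[int]_n) k : emb R (y *+ k) = k%:R *: emb R y.
Proof. by apply/rowP => i; rewrite !mxE mulmxnE rmorphMn /= mulr_natl. Qed.

(** The lattice points of a half-open cube, as a list without repetition. *)
Definition box n (a : int) (N : nat) : seq 'rV[int]_n :=
  [seq \row_i (a + (f i : nat)%:Z) | f : {ffun 'I_n -> 'I_N}].

Lemma box_uniq n a N : uniq (box n a N).
Proof.
rewrite map_inj_uniq ?enum_uniq// => f g fg; apply/ffunP => i; apply/val_inj.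
by have /rowP/(_ i) := fg; rewrite !mxE => /addrI[].
Qed.

Lemma size_box n a N : size (box n a N) = (N ^ n)%N.
Proof. by rewrite size_map -cardE card_ffun !card_ord. Qed.

Lemma mem_box n a N (y : 'rV[int]_n) :
  (y \in box n a N) = [forall i, a <= y 0 i < a + N%:Z].
Proof.
apply/mapP/forallP => [[f _ ->] i|H].
  rewrite mxE; have := ltn_ord (f i); move: (nat_of_ord _) => k kN. apply/andP; split; lia.
have H' i : (`|(y 0 i - a)%R| < N)%N by have := H i; lia.
exists [ffun i => Ordinal (H' i)]; first by rewrite mem_enum.
by apply/rowP => i; rewrite !mxE ffunE /=; have := H i; lia.
Qed.

(** * A finite test for closeness to a seminorm *)

Lemma exists_pow2_ge (R : realType) (x : R) : exists k, x <= 2 ^+ k.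
Proof.
exists (Num.truncn x).+1; apply/ltW/(lt_le_trans (truncnS_gt x)).
by rewrite -natrX ler_nat ltnW// ltn_expl.
Qed.

(** The net consists of dyadic rationals so that, multiplied by a large power of 2,
    its members become lattice vectors. *)
Lemma exists_lattice_net (R : realType) n kappa : exists (I : finType) (w : I -> 'rV[int]_n),
  (forall p, `|2 ^- kappa *: emb R (w p)| <= 3) /\
  (forall v : 'rV[R]_n, `|v| <= 3 -> exists p, `|v - 2 ^- kappa *: emb R (w p)| <= 2 ^- kappa).
Proof.
pose K := (2 ^ kappa)%N; have K0 : (0 : R) < K%:R by rewrite ltr0n expn_gt0.
have KE : 2 ^+ kappa = K%:R :> R by rewrite natrX.
exists {ffun 'I_n -> 'I_(6 * K).+1},
  (fun f : {ffun 'I_n -> 'I_(6 * K).+1} => \row_i ((f i : nat)%:Z - (3 * K)%:Z)).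
rewrite KE; split => [f|v v3].
  apply/rV_norm_le => // i; rewrite !mxE normrM gtr0_norm ?invr_gt0//.
  rewrite ler_pdivrMl// -[leRHS]natrM -intr_norm -[leRHS]/(((K * 3)%N%:Z)%:~R) ler_int.
  by have := ltn_ord (f i); move: (nat_of_ord _) => a; lia.
have {}v3 := (rV_norm_le v (ler0n R 3)).1 v3.
have vi i : 0 <= K%:R * (v 0 i + 3) by rewrite mulr_ge0 ?ler0n//;
  have := v3 i; rewrite ler_norml; lra.
have vI i : (Num.truncn (K%:R * (v 0%R i + 3)) < (6 * K).+1)%N.
  rewrite ltnS -(ler_nat R) natrM [leRHS]mulrC; apply: (@le_trans _ _ (K%:R * (v 0 i + 3))).
    by rewrite truncn_le.
  by rewrite ler_wpM2l ?ler0n//; have := v3 i; rewrite ler_norml; lra.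
exists [ffun i => Ordinal (vI i)]; apply/rV_norm_le; first by rewrite invr_ge0 ltW.
move=> i; rewrite !mxE ffunE /= rmorphB /= -!pmulrn.
have /andP[] := truncn_itv (vi i); move: (Num.truncn _) => a a1 a2.
have -> : v 0 i - K%:R^-1 * (a%:R - (3 * K)%:R) = (K%:R * (v 0 i + 3) - a%:R) / K%:R.
  by rewrite natrM; field; rewrite gt_eqF.
rewrite normrM [X in _ * X]gtr0_norm ?invr_gt0// ler_piMl ?invr_ge0 ?ler0n//.
by rewrite ler_norml; move: a2; rewrite -natr1; lra.
Qed.

(** The parameters of [straight_near_seminorm] are chosen as powers of 2, so that the
    directions are lattice vectors and the pieces of a segment are dyadic.  They depend
    only on [n] and [delta]. *)
Lemma finite_test (R : realType) n (delta : R) : 0 < delta ->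
  exists (I : finType) (v : I -> 'rV[int]_n) (m : nat) (eps Y : R),
  [/\ (0 < m)%N, 0 < eps &
   forall D : 'rV[R]_n -> 'rV[R]_n -> R, short_pseudometric D ->
   (forall p y, `|y| <= Y -> straight D (2 ^ m) eps y (emb R (v p))) ->
   near_seminorm delta D].
Proof.
move=> d0; pose e := delta / 9; have e0 : 0 < e by rewrite divr_gt0.
have [kappa ke] := exists_pow2_ge e^-1.
have {ke} ke : 2 ^- kappa <= e by rewrite -[e]invrK lef_pV2 ?posrE ?exprn_gt0 ?invr_gt0.
have [I [w [w3 net]]] := exists_lattice_net R n kappa.
pose a : R := #|I|%:R + 1; have a0 : 0 < a by rewrite ltr_wpDl.
pose eps := delta / (3 * a); have eps0 : 0 < eps by rewrite divr_gt0// mulr_gt0.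
pose c := 3 / e * (2 * (2 + 18 / e)).
have ie0 : 0 < e^-1 by rewrite invr_gt0.
have c0 : 0 < c by rewrite !mulr_gt0// addr_gt0// mulr_gt0.
have [sigma] := exists_pow2_ge (3 / e + 12 / delta + c / eps).
have [tau] := exists_pow2_ge (3 / eps).
set S : R := 2 ^+ sigma; set k : R := 2 ^+ tau => kle Sle.
have S0 : 0 < S by exact: exprn_gt0.
have k0 : 0 < k by exact: exprn_gt0.
have p1 : 0 < 3 / e by rewrite divr_gt0.
have p2 : 0 < 12 / delta by rewrite divr_gt0.
have p3 : 0 < c / eps by rewrite divr_gt0.
have Sk : S <= (2 ^ (kappa + sigma))%:R by rewrite /S -natrX ler_nat leq_exp2l// leq_addl.
have S'0 : (0 : R) < (2 ^ (kappa + sigma))%:R by rewrite ltr0n expn_gt0.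
exists I, (fun p => w p *+ 2 ^ sigma), (kappa + sigma + tau).+1, eps, (2 + 18 / e).
split => // D sD st.
apply: (@straight_near_seminorm _ _ _ sD _ (fun p => 2 ^- kappa *: emb R (w p))
  (2 ^ (kappa + sigma)) (2 ^ tau.+1) e eps delta) => //; rewrite ?expn_gt0//.
- exact: ltW.
- by move=> v /net[p pe]; exists p; exact: le_trans ke.
- by apply: le_trans Sk; lra.
- move=> p y yY; rewrite -expnD addnS; have := st p y yY.
  rewrite embMn scalerA expnD natrM !natrX mulrAC divff ?mul1r// expf_neq0//.
- have : 4 / (2 ^ (kappa + sigma))%:R <= delta / 3.
    rewrite ler_pdivrMr// -ler_pdivrMl ?divr_gt0//; apply: le_trans Sk.
    have -> : (delta / 3)^-1 * 4 = 12 / delta by field; rewrite gt_eqF.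
    lra.
  have : eps <= delta / 3.
    rewrite /eps ler_wpM2l ?(ltW d0)// lef_pV2 ?posrE ?mulr_gt0//.
    by have := ler0n R #|I|; rewrite /a; lra.
  rewrite /e; lra.
- have h1 : c / (2 ^ (kappa + sigma))%:R <= eps.
    by rewrite ler_pdivrMr// -ler_pdivrMl//; apply: le_trans Sk; rewrite mulrC; lra.
  have h2 : 3 / (2 ^ tau.+1)%:R <= eps.
    rewrite ler_pdivrMr ?ltr0n ?expn_gt0// -ler_pdivrMl// mulrC; apply: le_trans kle _.
    by rewrite natrX ler_eXn2l ?ltr1n.
  apply: (@le_trans _ _ (#|I|%:R * (3 * eps))).
    by rewrite ler_wpM2l// -/c; lra.
  rewrite /eps; have -> : #|I|%:R * (3 * (delta / (3 * a))) = delta * (#|I|%:R / a).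
    by field; rewrite gt_eqF.
  by rewrite ler_piMr ?(ltW d0)// ler_pdivrMr// mul1r /a lerDl.
Qed.

(** * Energy of difference quotients along a lattice direction *)

(** In terms of the mean [b] of the [a i], the right-hand side exceeds the left-hand
    side by [2 M c (b - c)]. *)
Lemma sum_sqr_deviation (R : realFieldType) M (a : 'I_M -> R) c :
  0 <= c -> M%:R * c <= \sum_i a i ->
  M%:R * c ^+ 2 + \sum_i (a i - c) ^+ 2 <= \sum_i a i ^+ 2.
Proof.
move=> c0 ca.
have -> : \sum_i (a i - c) ^+ 2 = \sum_i a i ^+ 2 - 2 * c * (\sum_i a i) + M%:R * c ^+ 2.
  have -> : M%:R * c ^+ 2 = \sum_(i < M) c ^+ 2 by rewrite sumr_const card_ord -[RHS]mulr_natl.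
  rewrite mulr_sumr -sumrB -big_split; apply: eq_bigr => i _ /=; ring.
have := ler_wpM2l c0 ca; rewrite expr2; lra.
Qed.

(** The regions over which the energies are summed shrink as the scale grows, fast
    enough that a segment issued at one scale stays in the region of the finer scale
    ([region_shift]); this absorbs all boundary terms.  Up to constants they remain
    comparable to the cube of side [2 ^ J]. *)
Definition half_width A J j := (A * (2 ^ (J + 2) - 2 ^ j.+1))%N.

Definition region n A J j : seq 'rV[int]_n :=
  box n (- (half_width A J j)%:Z) (2 * half_width A J j).

Lemma mem_region n A J j (y : 'rV[int]_n) :
  (y \in region n A J j) =
  [forall i, - (half_width A J j)%:Z <= y 0 i < (half_width A J j)%:Z].
Proof. by rewrite mem_box; apply: eq_forallb => i; congr (_ && (_ < _)); lia. Qed.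

Section Energy.
Context {R : realType} {n : nat} (D : 'rV[R]_n -> 'rV[R]_n -> R).
Hypothesis sD : short_pseudometric D.

Definition slope (v : 'rV[int]_n) j y : R :=
  D (emb R y) (emb R (y + v *+ 2 ^ j)) / 2 ^+ j.

Variables (v : 'rV[int]_n) (A m J : nat).
Hypothesis vA : forall i, `|v 0 i| <= A%:Z.
Hypothesis m0 : (0 < m)%N.

Lemma slope_ge0 j y : 0 <= slope v j y.
Proof. by case: sD => D0 _ _ _; rewrite divr_ge0// exprn_ge0. Qed.

Lemma slope_le j y : slope v j y <= A%:R.
Proof.
case: sD => _ _ _ D1; rewrite ler_pdivrMr ?exprn_gt0//; apply: le_trans (D1 _ _) _.
rewrite embD opprD addrA subrr sub0r normrN embMn normrZ ger0_norm ?ler0n// mulrC natrX.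
rewrite ler_wpM2r ?exprn_ge0//; apply/rV_norm_le => // i.
by rewrite mxE -intr_norm -[leRHS]/((A%:Z)%:~R) ler_int.
Qed.

Lemma region_shift j i y : (j + m <= J)%N -> (i <= 2 ^ m)%N -> y \in region n A J (j + m) ->
  y + v *+ (i * 2 ^ j) \in region n A J j.
Proof.
move=> jJ im; rewrite !mem_region => /forallP H; apply/forallP => k.
have := H k; have := vA k; rewrite !mxE mulmxnE.
have : (half_width A J (j + m) + A * (i * 2 ^ j) <= half_width A J j)%N.
  rewrite /half_width -mulnDr leq_mul2l; apply/orP; right.
  have : (2 ^ (j + m).+1 <= 2 ^ (J + 2))%N by rewrite leq_exp2l//; lia.
  have : (2 ^ j.+1 + i * 2 ^ j <= 2 ^ (j + m).+1)%N.
    have : (i * 2 ^ j <= 2 ^ (j + m))%N by rewrite expnD mulnC leq_mul2l im orbT.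
    have : (2 ^ j.+1 <= 2 ^ (j + m))%N by rewrite leq_exp2l//; lia.
    by rewrite (expnS 2 (j + m)); lia.
  lia.
move: (half_width _ _ _) (half_width _ _ _) (v 0 k) (y 0 k) (i * 2 ^ j)%N => a b c d e.
rewrite -mulr_natr => abe cA dA.
have : `|c * e%:R| <= (A * e)%N%:Z.
  by rewrite normrM PoszM natz ler_wpM2r.
move: abe dA; move: (A * e)%N (c * _) => f g fb /andP[d1 d2].
  by rewrite ler_norml => /andP[g1 g2]; apply/andP; split; lia.
Qed.

Definition energy j : R := \sum_(y <- region n A J j) slope v j y ^+ 2.

Definition deviation i j : R :=
  \sum_(y <- region n A J (j + m)) (slope v j (y + v *+ (i * 2 ^ j)) - slope v (j + m) y) ^+ 2.

(** The inequality of [sum_sqr_deviation] summed over the region; each of the [2 ^ m]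
    translated sums of squares is at most the energy of the finer scale. *)
Lemma energy_step j : (j + m <= J)%N ->
  2 ^+ m * energy (j + m) + \sum_(i < 2 ^ m) deviation i j <= 2 ^+ m * energy j.
Proof.
move=> jJ.
have -> : \sum_(i < 2 ^ m) deviation i j = \sum_(y <- region n A J (j + m))
    \sum_(i < 2 ^ m) (slope v j (y + v *+ (i * 2 ^ j)) - slope v (j + m) y) ^+ 2.
  exact: exchange_big.
rewrite mulr_sumr -big_split /=.
apply: (@le_trans _ _ (\sum_(y <- region n A J (j + m)) \sum_(i < 2 ^ m)
    slope v j (y + v *+ (i * 2 ^ j)) ^+ 2)).
  apply: ler_sum => y _; rewrite -natrX; apply: sum_sqr_deviation; first exact: slope_ge0.
  have := short_path sD (fun i => emb R (y + v *+ (i * 2 ^ j))) (2 ^ m).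
  rewrite mul0n mulr0n addr0 -expnD addnC => H.
  rewrite /slope mulrA ler_pdivrMr ?exprn_gt0// exprD natrX mulrC.
  rewrite mulrA ler_wpM2r ?exprn_ge0//.
  apply: le_trans H _; rewrite mulr_suml; apply: ler_sum => i _.
  by rewrite divfK ?expf_neq0// -addrA -mulrnDr mulSnr.
rewrite exchange_big -natrX mulr_natl -[X in _ *+ X](card_ord (2 ^ m)) -sumr_const.
apply: ler_sum => i _.
apply: (ler_sum_seq_inj (F := fun y => slope v j y ^+ 2) (h := fun y => y + v *+ (i * 2 ^ j))).
- exact: box_uniq.
- exact: box_uniq.
- by move=> x y _ _ /addIr.
- by move=> y; apply: region_shift => //; exact: ltnW.
- by move=> y; rewrite sqr_ge0.
Qed.

Lemma energy_le j : energy j <= A%:R ^+ 2 * (A * 2 ^ (J + 3))%:R ^+ n.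
Proof.
apply: (@le_trans _ _ (\sum_(y <- region n A J j) A%:R ^+ 2)).
  by apply: ler_sum => y _; rewrite lerXn2r ?nnegrE ?slope_ge0 ?slope_le.
rewrite big_const_seq count_predT size_box iter_addr_0 -[leLHS]mulr_natr.
rewrite ler_wpM2l ?sqr_ge0// natrX lerXn2r ?nnegrE// ler_nat /half_width.
by rewrite mulnCA leq_mul2l !expnD; apply/orP; right; lia.
Qed.

(** The differences of energies [m] scales apart telescope, leaving the energies of the
    [m] finest scales. *)
Lemma total_deviation_le K : (K + m <= J.+1)%N ->
  \sum_(j < K) \sum_(i < 2 ^ m) deviation i j
    <= 2 ^+ m * (m%:R * (A%:R ^+ 2 * (A * 2 ^ (J + 3))%:R ^+ n)).
Proof.
move=> KJ; apply: (@le_trans _ _ (2 ^+ m * \sum_(i < m) energy i)); last first.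
  rewrite ler_wpM2l ?exprn_ge0// -[m in m%:R]card_ord mulr_natl -sumr_const.
  by apply: ler_sum => i _; exact: energy_le.
suff H : \sum_(j < K) \sum_(i < 2 ^ m) deviation i j + 2 ^+ m * \sum_(i < m) energy (K + i)
    <= 2 ^+ m * \sum_(i < m) energy i.
  apply: le_trans H; rewrite lerDl mulr_ge0 ?exprn_ge0// sumr_ge0// => i _.
  by apply: sumr_ge0 => y _; rewrite sqr_ge0.
elim: K KJ => [|K IH] KJ; first by rewrite big_ord0 add0r.
have : (K + m <= J.+1)%N by lia.
move=> /IH; rewrite big_ord_recr /=.
have := @energy_step K; have KJ' : (K + m <= J)%N by lia.
move=> /(_ KJ').
have : energy K + \sum_(i < m) energy (K.+1 + i) = \sum_(i < m) energy (K + i) + energy (K + m).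
  rewrite -[RHS](big_ord_recr m (fun i => energy (K + i)%N)) big_ord_recl /= addn0.
  by congr (_ + _); apply: eq_bigr => i _; rewrite /bump /= add1n addSnnS.
move=> E; have := congr1 (fun x => 2 ^+ m * x) E; rewrite !mulrDr; lra.
Qed.
End Energy.

(** * Packing of the cubes that fail the test *)

(** The lattice points of the subcube of side [2 ^ (l - g)] at position [o] relative to
    the cube of side [2 ^ l] and index [q]; [o] may well point outside that cube. *)
Definition cell n l g (q o : 'rV[int]_n) : seq 'rV[int]_n :=
  [seq q *+ 2 ^ l + o *+ 2 ^ (l - g) + z | z <- box n 0 (2 ^ (l - g))].

Lemma cell_uniq n l g (q o : 'rV[int]_n) : uniq (cell l g q o).
Proof. by rewrite map_inj_uniq ?box_uniq// => x y /addrI. Qed.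

Lemma cell_inj n l g (q q' o y : 'rV[int]_n) :
  y \in cell l g q o -> y \in cell l g q' o -> q = q'.
Proof.
move=> /mapP[z]; rewrite mem_box => /forallP zb -> /mapP[z']; rewrite mem_box => /forallP zb' E.
have {}E : q *+ 2 ^ l + z = q' *+ 2 ^ l + z'.
  by apply: (addIr (o *+ 2 ^ (l - g))); rewrite addrAC E addrAC.
apply/rowP => i; have := congr1 (fun y : 'rV[int]_n => y 0 i) E; rewrite !mxE !mulmxnE.
have := zb i; have := zb' i; have : (2 ^ (l - g) <= 2 ^ l)%N by rewrite leq_exp2l// leq_subr.
rewrite -[q 0 i *+ 2 ^ l]mulr_natr -[q' 0 i *+ 2 ^ l]mulr_natr !natz !add0r.
move: (q 0 i) (q' 0 i) (z 0 i) (z' 0 i) (2 ^ l)%N (2 ^ (l - g))%N.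
move=> a b c d P P1 PP /andP[d1 d2] /andP[c1 c2] eq.
have [] : a <= b /\ b <= a; last by lia.
have ltM (s t : int) : s < t -> s * P%:Z + P%:Z <= t * P%:Z.
  by move=> st; rewrite -[X in _ + X]mul1r -mulrDl ler_wpM2r//; lia.
by split; rewrite leNgt; apply/negP => /ltM; lia.
Qed.

Section CellPacking.
Context {R : realType} {n : nat} (D : 'rV[R]_n -> 'rV[R]_n -> R).
Hypothesis sD : short_pseudometric D.

(** For a fixed direction [v], piece [i] and relative position [o], cubes of the same
    size have disjoint cells, each of which has a share [2 ^ (- g * n)] of the cube and
    contributes to the deviation at its own scale only. *)
Lemma cell_packing (v : 'rV[int]_n) (A m J g i : nat) (o : 'rV[int]_n) (e : R)
    (T : eqType) (X : seq T) (lev : T -> nat) (idx : T -> 'rV[int]_n) :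
  (forall i, `|v 0 i| <= A%:Z) -> (0 < m)%N -> (i < 2 ^ m)%N -> 0 <= e ->
  uniq X -> {in X &, injective (fun t => (lev t, idx t))} ->
  (forall t, t \in X -> m + g <= lev t <= J)%N ->
  (forall t y, t \in X -> y \in cell (lev t) g (idx t) o ->
     y \in region n A J (lev t) /\
     e <= slope D v (lev t - m) (y + v *+ (i * 2 ^ (lev t - m))) - slope D v (lev t) y) ->
  e ^+ 2 * \sum_(t <- X) (2 ^+ lev t) ^+ n <=
    (2 ^+ g) ^+ n * (2 ^+ m * (m%:R * (A%:R ^+ 2 * (A * 2 ^ (J + 3))%:R ^+ n))).
Proof.
move=> vA m0 im e0 uX inj levX H.
have [mJ|Jm] := leqP m J; last first.
  case: X uX inj levX H => [|t X] _ _ levX _; last first.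
    by have := levX t; rewrite mem_head => /(_ isT); lia.
  by rewrite big_nil mulr0 !mulr_ge0 ?exprn_ge0.
pose F (p : nat * 'rV[int]_n) :=
  (slope D v p.1 (p.2 + v *+ (i * 2 ^ p.1)) - slope D v (p.1 + m) p.2) ^+ 2.
pose s := [seq (t, y) | t <- X, y <- cell (lev t) g (idx t) o].
pose s' : seq (nat * 'rV[int]_n) :=
  [seq (j, y) | j <- iota 0 (J.+1 - m), y <- region n A J (j + m)].
have mem_s p : p \in s -> p.1 \in X /\ p.2 \in cell (lev p.1) g (idx p.1) o.
  by move=> /allpairsPdep[t [y [tX yc ->]]].
apply: (@le_trans _ _ ((2 ^+ g) ^+ n * \sum_(p <- s) F (lev p.1 - m, p.2)%N)).
  rewrite big_allpairs_dep /= !mulr_sumr big_seq [leRHS]big_seq; apply: ler_sum => t tX.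
  have /andP[lt1 lt2] := levX t tX.
  apply: (@le_trans _ _ ((2 ^+ g) ^+ n * \sum_(y <- cell (lev t) g (idx t) o) e ^+ 2)).
    rewrite big_const_seq count_predT size_map size_box iter_addr_0 -[_ *+ (_ ^ _)%N]mulr_natr.
    have gl : (g <= lev t)%N by lia.
    by rewrite !natrX [leRHS]mulrCA -exprMn -exprD subnKC.
  rewrite ler_wpM2l ?exprn_ge0// big_seq [leRHS]big_seq; apply: ler_sum => y yc.
  have [_ he] := H t y tX yc.
  have lm : (lev t - m + m)%N = lev t by lia.
  by rewrite /F /= lm lerXn2r ?nnegrE// (le_trans e0).
rewrite ler_wpM2l ?exprn_ge0//.
apply: (@le_trans _ _ (\sum_(p <- s') F p)).
  apply: (ler_sum_seq_inj (F := F) (h := fun p => (lev p.1 - m, p.2)%N)).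
  - apply: allpairs_uniq_dep => //; first by move=> t _; exact: cell_uniq.
    by move=> [t y] [t' y'] _ _ [-> ->].
  - apply: allpairs_uniq_dep; first exact: iota_uniq.
      by move=> j _; exact: box_uniq.
    by move=> [t y] [t' y'] _ _ [-> ->].
  - move=> [t y] [t' y'] /mem_s[/= tX yc] /mem_s[/= tX' yc'] [el ey].
    have {}el : lev t = lev t' by have := levX t tX; have := levX t' tX'; lia.
    congr (_, _) => //; apply: inj => //; rewrite el; congr (_, _).
    by rewrite -ey -el in yc'; exact: cell_inj yc yc'.
  - move=> [t y] /mem_s[/= tX yc]; have [yr _] := H t y tX yc.
    have := levX t tX => lt; apply/allpairsPdep; exists (lev t - m)%N, y; split => //.
      by rewrite mem_iota; lia.
    by have -> : (lev t - m + m)%N = lev t by lia.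
  - by move=> p; rewrite sqr_ge0.
have KJ : (J.+1 - m + m <= J.+1)%N by lia.
apply: le_trans (total_deviation_le sD vA m0 KJ).
have E : iota 0 (J.+1 - m) = index_iota 0 (J.+1 - m) by rewrite /index_iota subn0.
rewrite big_allpairs_dep /= E big_mkord; apply: ler_sum => j _.
rewrite (bigD1 (Ordinal im))//= lerDl; apply: sumr_ge0 => k _.
by apply: sumr_ge0 => y _; rewrite sqr_ge0.
Qed.
End CellPacking.

(** The integer vector [o] marks the subcube that contains the base point [y] of the
    violation, in the coordinates of the cube.  Replacing [y] by another point of this
    subcube moves all end points by at most [2 ^ (l - g)]; [g] is so large that half of
    [eps] survives. *)
Lemma defect_slope (R : realType) n (D : 'rV[R]_n -> 'rV[R]_n -> R) (q o v z : 'rV[int]_n)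
    (l g m i : nat) (eps : R) (y : 'rV[R]_n) :
  short_pseudometric D -> (m + g <= l)%N -> (2 * 2 ^+ m + 2) * 2 <= eps * 2 ^+ g ->
  (forall k, (o 0 k)%:~R <= 2 ^+ g * y 0 k < (o 0 k + 1)%:~R) ->
  let E := rescale (emb R (q *+ 2 ^ l)) (2 ^+ l) D in
  E y (y + emb R v) + eps < (2 ^ m)%:R * E (y + (i%:R / (2 ^ m)%:R) *: emb R v)
      (y + (i.+1%:R / (2 ^ m)%:R) *: emb R v) ->
  z \in cell l g q o ->
  eps / 2 <= slope D v (l - m) (z + v *+ (i * 2 ^ (l - m))) - slope D v l z.
Proof.
move=> sD mgl epsg oy E; rewrite /E /rescale => {E}.
set a := emb R (q *+ 2 ^ l); set P : R := 2 ^+ l.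
have P0 : 0 < P by exact: exprn_gt0.
set M : R := (2 ^ m)%:R; have M0 : 0 < M by rewrite ltr0n expn_gt0.
pose G : R := 2 ^+ g; have G0 : 0 < G by exact: exprn_gt0.
have PM : 2 ^+ (l - m) = P / M :> R.
  by rewrite /P /M natrX -[in RHS](@subnK m l) ?exprD ?mulfK ?expf_neq0//; lia.
have PG : 2 ^+ (l - g) = P / G :> R.
  by rewrite /P /G -[in RHS](@subnK g l) ?exprD ?mulfK ?expf_neq0//; lia.
move=> H zc.
have za : `|a + P *: y - emb R z| <= P / G.
  apply/rV_norm_le; first by rewrite divr_ge0 ?ltW.
  case/mapP: zc => w; rewrite mem_box => /forallP wb -> k.
  rewrite /a !embD !embMn !natrX -/P PG !mxE; have /andP[y1 y2] := oy k.
  have /andP[] := wb k; rewrite add0r => w1 w2.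
  have {w1}w1 : (0 : R) <= (w 0 k)%:~R by rewrite ler0z.
  have {w2}w2 : (w 0 k)%:~R < P / G by rewrite -PG -natrX -[ltRHS]/((_%:Z)%:~R) ltr_int.
  have PG0 : 0 < P / G by rewrite divr_gt0.
  move: y2; rewrite rmorphD /= -/G => y2.
  have := ler_wpM2l (ltW PG0) y1; have := ltr_pM2l PG0 (G * y 0 k) ((o 0 k)%:~R + 1).
  rewrite y2 [P / G * (G * _)]mulrA divfK ?gt_eqF// -/G.
  rewrite mulrDr mulr1 ler_norml; lra.
set v' := emb R v in H *.
have S1 : (M / P) * D (a + P *: (y + (i%:R / M) *: v')) (a + P *: (y + (i.+1%:R / M) *: v'))
    <= slope D v (l - m) (z + v *+ (i * 2 ^ (l - m))) + 2 * M / G.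
  have -> : slope D v (l - m) (z + v *+ (i * 2 ^ (l - m))) + 2 * M / G =
      M / P * (D (emb R z + (i%:R * (P / M)) *: v') (emb R z + (i.+1%:R * (P / M)) *: v')
               + P / G + P / G).
    rewrite /slope -addrA -mulrnDr -mulSnr !embD !embMn -/v' !natrM !natrX PM.
    by field; rewrite !gt_eqF.
  rewrite ler_wpM2l ?divr_ge0 ?(ltW M0) ?(ltW P0)//; apply: le_trans (short_perturb sD _ _
    (emb R z + (i%:R * (P / M)) *: v') (emb R z + (i.+1%:R * (P / M)) *: v')) _.
  have cE (c : R) : a + P *: (y + (c / M) *: v') - (emb R z + (c * (P / M)) *: v') =
      a + P *: y - emb R z.
    have -> : c * (P / M) = P * (c / M) by field; rewrite gt_eqF.
    by rewrite scalerDr addrA scalerA opprD addrACA subrr addr0.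
  by rewrite !cE; exact: lerD (lerD (lexx _) za) za.
have S2 : slope D v l z <= P^-1 * D (a + P *: y) (a + P *: (y + v')) + 2 / G.
  have -> : P^-1 * D (a + P *: y) (a + P *: (y + v')) + 2 / G =
      (D (a + P *: y) (a + P *: (y + v')) + P / G + P / G) / P.
    by field; rewrite !gt_eqF.
  rewrite /slope -/P ler_wpM2r ?invr_ge0 ?(ltW P0)//.
  rewrite embD embMn natrX -/P -/v'; apply: le_trans (short_perturb sD _ _ (a + P *: y) (a + P *: (y + v'))) _.
  have -> : emb R z + P *: v' - (a + P *: (y + v')) = - (a + P *: y - emb R z).
    by rewrite scalerDr addrA [in LHS]opprD addrACA subrr addr0 opprB.
  by rewrite (distrC (emb R z)) normrN; exact: lerD (lerD (lexx _) za) za.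
have S3 : 2 * M / G + 2 / G <= eps / 2.
  rewrite -mulrDl ler_pdivrMr//; move: epsg; rewrite -natrX -/M -/G; lra.
move: H S1; rewrite !mulrA; lra.
Qed.

(** A cube that is not near a seminorm fails the finite test at one of finitely many
    triples (direction, piece, relative position of the base point); [cell_packing]
    bounds the cubes attached to each triple. *)
Lemma lattice_packing (R : realType) n (delta : R) : 0 < delta ->
  exists (l0 : nat) (C : R), forall (D : 'rV[R]_n -> 'rV[R]_n -> R) (J : nat) (T : eqType)
      (X : seq T) (lev : T -> nat) (idx : T -> 'rV[int]_n),
    short_pseudometric D -> uniq X -> {in X &, injective (fun t => (lev t, idx t))} ->
    (forall t, t \in X -> l0 <= lev t <= J)%N ->
    (forall t i, t \in X -> 0 <= idx t 0 i *+ 2 ^ lev t < (2 ^ J)%N) ->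
    (forall t, t \in X ->
       ~ near_seminorm delta (rescale (emb R (idx t *+ 2 ^ lev t)) (2 ^+ lev t) D)) ->
    \sum_(t <- X) (2 ^+ lev t) ^+ n <= C * (2 ^+ J) ^+ n.
Proof.
move=> d0; have [I [v [m [eps [Y [m0 eps0 test]]]]]] := finite_test n d0.
have [g] := exists_pow2_ge ((2 * 2 ^+ m + 2) * 2 / eps);
  rewrite ler_pdivrMr// [leRHS]mulrC => ge.
(* [O] bounds the position of the cells; [A] bounds the directions and is large enough
   for all cells to lie in the regions of summation. *)
pose Y' := (Num.truncn Y).+1; have YY : Y <= Y'%:R by apply/ltW/truncnS_gt.
pose O := (2 ^ g * Y')%N.+1.
pose A := ((\max_p \max_i `|v p 0%R i|%N) + Y' + 3)%N.
have vA p i : `|v p 0 i| <= A%:Z.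
  have : (`|v p 0%R i|%N <= A)%N.
    rewrite /A -addnA; apply: leq_trans (leq_addr _ _).
    exact: leq_trans (leq_bigmax i) (leq_bigmax (F := fun p => \max_i `|v p 0%R i|%N) p).
  lia.
pose Ks := [seq (pi, o) | pi <- enum {: I * 'I_(2 ^ m)}, o <- box n (- O%:Z) (2 * O)].
pose B : R := (2 ^+ g) ^+ n * (2 ^+ m * (m%:R * (A%:R ^+ 2 * (A * 8)%:R ^+ n))).
exists (m + g)%N, ((size Ks)%:R * B / (eps / 2) ^+ 2) => D J T X lev idx sD uX inj levX idxX nf.
have e20 : 0 < (eps / 2) ^+ 2 by rewrite exprn_gt0// divr_gt0.
rewrite mulrAC ler_pdivlMr// mulrC.
pose bad (k : I * 'I_(2 ^ m) * 'rV[int]_n) : pred T := fun t =>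
  all (fun y => eps / 2 <= slope D (v k.1.1) (lev t - m) (y + v k.1.1 *+ (k.1.2 * 2 ^ (lev t - m)))
       - slope D (v k.1.1) (lev t) y) (cell (lev t) g (idx t) k.2).
rewrite mulr_sumr -mulrA; apply: (@sum_le_cover _ _ _ _ _ bad).
- by move=> t; rewrite mulr_ge0 ?(ltW e20)// !exprn_ge0.
- move=> t tX; apply: contrapT => nb; apply: (nf t tX).
  apply: test => [|p y yY i im]; first by apply: short_rescale; rewrite ?exprn_gt0.
  rewrite leNgt; apply/negP => H; apply: nb.
  have fl k : (Num.floor (2 ^+ g * y 0 k))%:~R <= 2 ^+ g * y 0 k <
      (Num.floor (2 ^+ g * y 0 k) + 1)%:~R by exact: floor_itv.
  exists ((p, Ordinal im), \row_k Num.floor (2 ^+ g * y 0 k)).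
    apply: allpairs_f; first by rewrite mem_enum.
    rewrite mem_box; apply/forallP => k; rewrite mxE.
    have : `|2 ^+ g * y 0 k| <= (2 ^ g * Y')%:R.
      rewrite normrM ger0_norm ?exprn_ge0// natrM natrX ler_wpM2l ?exprn_ge0//.
      by apply: (rV_norm_le y (ler0n _ _)).1; exact: le_trans YY.
    rewrite ler_norml => /andP[f1 f2]; have /andP[f3 f4] := fl k.
    have {f1 f4} := le_lt_trans f1 f4; have {f2 f3} := le_trans f3 f2.
    rewrite -[X in _ <= X -> _]/((_%:Z)%:~R) ler_int => h1.
    rewrite -[X in - X < _ -> _]/((_%:Z)%:~R) -rmorphN ltr_int => h2.
    rewrite /O; move: h1 h2; move: (2 ^ g * Y')%N (Num.floor _) => b c h1 h2.
    by apply/andP; split; lia.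
  apply/allP => z zc; apply: (defect_slope (q := idx t) (g := g) (y := y)) zc => //.
  - by have := levX t tX; lia.
  - by move=> k; rewrite mxE.
move=> k /allpairsP[[[p i] o] /= [_ ob ->]] {k}.
rewrite -mulr_sumr -big_filter.
apply: le_trans (cell_packing sD (v := v p) (A := A) (m := m) (J := J) (g := g)
   (i := i) (o := o) (lev := lev) (idx := idx) _ _ _ _ _ _ _ _) _ => //.
- by rewrite divr_ge0// ltW.
- exact: filter_uniq.
- by move=> t t'; rewrite !mem_filter => /andP[_ tX] /andP[_ tX']; apply: inj.
- by move=> t; rewrite mem_filter => /andP[_ /levX]; lia.
- move=> t y; rewrite mem_filter => /andP[/allP/= bt tX] yc; split; last exact: bt.
  rewrite mem_region; apply/forallP => k.
  case/mapP: yc => z; rewrite mem_box => /forallP/(_ k) zb ->.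
  have := idxX t k tX; move: ob; rewrite mem_box => /forallP/(_ k) ob.
  have /andP[lg lJ] := levX t tX.
  have P1 : (2 ^ (lev t).+1 <= 2 ^ J.+1)%N by rewrite leq_exp2l.
  have P2 : (2 ^ (lev t - g) <= 2 ^ lev t)%N by rewrite leq_exp2l// leq_subr.
  have P3 : (O * 2 ^ (lev t - g) = 2 ^ lev t * Y' + 2 ^ (lev t - g))%N.
    by rewrite /O mulSn addnC mulnAC -expnD subnKC//; lia.
  have P4 : ((Y' + 3) * 2 ^ J.+1 <= half_width A J (lev t))%N.
    rewrite /half_width; apply: leq_mul; first by rewrite /A -addnA leq_addl.
    by rewrite addn2 [(2 ^ J.+2)%N]expnS; lia.
  have P5 : (2 ^ lev t * Y' <= Y' * 2 ^ J)%N by rewrite mulnC leq_mul2l leq_exp2l// lJ orbT.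
  have P6 : ((Y' + 3) * 2 ^ J.+1 = 2 * (Y' * 2 ^ J) + 6 * 2 ^ J)%N.
    by rewrite expnS; ring.
  have P7 : (2 ^ lev t <= 2 ^ J)%N by rewrite leq_exp2l.
  have P8 : `|o 0 k *+ 2 ^ (lev t - g)| <= (O * 2 ^ (lev t - g))%N%:Z.
    rewrite -(mulr_natr (o 0 k)) natz normrM PoszM ler_wpM2r//.
    by move: ob; move: (o 0 k) (O) => x N /andP[b1 b2]; lia.
  rewrite !mxE !mulmxnE; move: P8; rewrite P3; move: P4; rewrite P6.
  move: P2 P5 P7 zb; move: (_ *+ _) (_ *+ _) (z 0 k) (half_width _ _ _) => f h w W.
  move: (2 ^ (lev t - g))%N (2 ^ lev t * Y')%N (2 ^ lev t)%N (2 ^ J)%N (Y' * _)%N => c d l K YJ.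
  move=> P2 P5 P7 /andP[z1 z2] P4; rewrite ler_norml => /andP[n1 n2] /andP[q1 q2].
  by apply/andP; split; lia.
- rewrite /B addnC expnD mulnA [(_ * 2 ^ J)%:R]natrM natrX exprMn.
  by rewrite !mulrA.
Qed.

(** * Dyadic cubes *)

(** The seminorm found in the coordinates of the cube is carried back by homogeneity.
    The division by [side (triple Q)] even gains a factor 3. *)
Lemma md_triple_le (R : realType) n (M : metricType R) (f : 'rV[R]_n -> M) (Q : cube R n)
    (lambda delta : R) (D : 'rV[R]_n -> 'rV[R]_n -> R) :
  0 <= lambda -> 0 < side Q -> 0 < delta ->
  (forall x y, mdist (f x) (f y) = lambda * D x y) ->
  near_seminorm delta (rescale (corner Q) (side Q) D) ->
  (md f (triple Q) <= (delta * lambda)%:E)%E.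
Proof.
move=> l0 s0 d0 fD [N [N0 NZ ND] HN].
have sE : side (triple Q) = 3 * side Q by [].
have s3 : 0 < 3 * side Q by rewrite mulr_gt0.
have H x y : points (triple Q) x -> points (triple Q) y ->
    `|mdist (f x) (f y) - lambda * N (x - y)| <= lambda * (side Q * delta).
  move=> Tx Ty; pose c z := (side Q)^-1 *: (z - corner Q).
  have cK z : corner Q + side Q *: c z = z.
    by rewrite /c scalerA divff ?gt_eqF// scale1r addrC subrK.
  have c_itv z i : points (triple Q) z -> -1 <= c z 0 i < 2.
    move=> /(_ i); rewrite sE /triple /cube_of_center /corner /Defs.center /= !mxE => zi.
    rewrite ler_pdivlMl// ltr_pdivrMl//; move: zi; rewrite /corner /side; lra.
  have cB z w : c z - c w = (side Q)^-1 *: (z - w).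
    by rewrite -scalerBr opprB addrA subrK.
  have := HN (c x) (c y); rewrite /rescale !cK => /(_ _ _ _) HH.
  have {}HH : `|(side Q)^-1 * D x y - N (c x - c y)| <= delta.
    have cI z i : points (triple Q) z -> -2 <= c z 0 i <= 2.
      by move=> /(c_itv z i); lra.
    apply: HH; apply/rV_norm_le => // i; rewrite ler_norml; try exact: cI.
    have -> : (c x - c y) 0 i = c x 0 i - c y 0 i by rewrite !mxE.
    by have := c_itv x i Tx; have := c_itv y i Ty; lra.
  have si : 0 < (side Q)^-1 by rewrite invr_gt0.
  move: HH; rewrite cB NZ (gtr0_norm si) -mulrBr normrM (gtr0_norm si).
  rewrite ler_pdivrMl// => HH.
  by rewrite fD -mulrBr normrM ger0_norm// ler_wpM2l.
rewrite /md sE; apply: (@le_trans _ _ ((3 * side Q)^-1%:E * (lambda * (side Q * delta))%:E)%E).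
  apply: lee_wpmul2l; first by rewrite lee_fin invr_ge0 ltW.
  apply: (@le_trans _ _ (ereal_sup [set `|mdist (f x) (f y) - lambda * N (x - y)|%:E
                               | x in points (triple Q) & y in points (triple Q)])).
    apply: ereal_inf_lbound; exists (fun x => lambda * N x) => //; split.
    - by move=> x; rewrite mulr_ge0.
    - by move=> a x; rewrite NZ mulrCA.
    - by move=> x y; rewrite -mulrDr ler_wpM2l.
  by apply: ge_ereal_sup => _ [x Tx [y Ty <-]]; rewrite lee_fin H.
rewrite -EFinM lee_fin.
have -> : (3 * side Q)^-1 * (lambda * (side Q * delta)) = lambda * delta / 3.
  by field; rewrite gt_eqF.
by have := mulr_ge0 l0 (ltW d0); lra.
Qed.

(** Dyadic subcubes are never larger than the cube, which takes [0 < n]; hence they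
    have lattice coordinates relative to its corner. *)
Lemma dyadic_coords (R : realType) n (Q0 : cube R n) : (1 <= n)%N -> dyadic Q0 ->
  exists k0 : int, side Q0 = 2 ^ k0 /\
  forall Q, dyadic_in Q0 Q -> exists (d : nat) (a : 'rV[int]_n),
    [/\ side Q = 2 ^ (k0 - d%:Z), corner Q = corner Q0 + side Q *: emb R a &
        forall i, 0 <= a 0 i < (2 ^ d)%N].
Proof.
move=> n0 [k0 [j0 ->]]; exists k0; split => // Q [[k [j ->]] sub].
have p2 (z : int) : (0 : R) < 2 ^ z by exact: exprz_gt0.
have i0 : 'I_n := Ordinal n0.
have inQ0 x i : points (\row_i ((j i)%:~R * 2 ^ k) : 'rV[R]_n, 2 ^ k) x ->
    (j0 i)%:~R * 2 ^ k0 <= x 0 i < (j0 i)%:~R * 2 ^ k0 + (2 : R) ^ k0.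
  by move=> /sub/(_ i); rewrite /corner /side /= mxE.
have kk0 : k <= k0.
  rewrite leNgt; apply/negP => k0k.
  pose c : 'rV[R]_n := \row_i ((j i)%:~R * 2 ^ k).
  have cQ : points (c, 2 ^ k : R) c.
    by move=> i; rewrite /corner /side /= lexx ltrDl p2.
  have cQ' : points (c, 2 ^ k : R) (c + const_mx (2 ^ k0)).
    move=> i; rewrite /corner /side /= [(c + _) 0 i]mxE [const_mx _ _ _]mxE lerDl ltW ?p2//= ltrD2l.
    by rewrite ltr_eXz2l// ltr1n.
  have := inQ0 _ i0 cQ; have := inQ0 _ i0 cQ'.
  by rewrite [(c + _) 0 i0]mxE [const_mx _ _ _]mxE; lra.
pose d := `|k0 - k|%N; have dE : k0 = k + d%:Z by rewrite /d; lia.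
have E : 2 ^ k0 = 2 ^ k * 2 ^+ d :> R by rewrite dE expfzDr.
exists d, (\row_i (j i - j0 i *+ 2 ^ d)); split.
- by rewrite /side /= dE addrK.
- apply/rowP => i; rewrite /corner /side /= !mxE E rmorphB /= rmorphMn /= -[_ *+ 2 ^ d]mulr_natr.
  by rewrite natrX; ring.
move=> i; rewrite mxE.
have cQ : points (\row_i ((j i)%:~R * 2 ^ k) : 'rV[R]_n, 2 ^ k) (\row_i ((j i)%:~R * 2 ^ k)).
  by move=> k'; rewrite /corner /side /= lexx ltrDl p2.
have aE : 2 ^ k * (j i - j0 i *+ 2 ^ d)%:~R = (j i)%:~R * 2 ^ k - (j0 i)%:~R * 2 ^ k0 :> R.
  by rewrite E rmorphB /= rmorphMn /= -[_ *+ 2 ^ d]mulr_natr natrX; ring.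
have := inQ0 _ i cQ; rewrite mxE => /andP[H1 H2].
have : 0 <= (2 : R) ^ k * (j i - j0 i *+ 2 ^ d)%:~R by rewrite aE subr_ge0.
have : 2 ^ k * (j i - j0 i *+ 2 ^ d)%:~R < 2 ^ k * ((2 ^ d)%N%:Z)%:~R :> R.
  by rewrite -[X in _ < _ * X]/((2 ^ d)%N%:R) natrX -E aE ltrBlDl.
by rewrite pmulr_rge0 ?p2// ltr_pM2l ?p2// ler0z ltr_int => -> ->.
Qed.

Unset Implicit Arguments.

Theorem theorem1p1 (R : realType) (n : nat) (hn : (1 <= n)%N)
    (delta : R) (hdelta : 0 < delta) :
  exists C : R,
    forall (M : metricType R) (L : R) (f : 'rV[R]_n -> M),
      is_Lipschitz L f ->
      forall Q0 : cube R n, dyadic Q0 ->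
        (\esum_(Q in [set Q | dyadic_in Q0 Q /\
                              (delta * L)%:E < md f (triple Q)]) vol Q
         <= C%:E * vol Q0)%E.
Proof.
have n0 : (0 : R) < n%:R by rewrite ltr0n.
have [l0 [C packing]] := lattice_packing n (divr_gt0 hdelta n0).
exists C => M L f fL Q0 dQ0; have [k0 [sQ0 coords]] := dyadic_coords hn dQ0.
have p2 (z : int) : (0 : R) < 2 ^ z by exact: exprz_gt0.
(* Two distinct points exist because the dimension is positive. *)
have L0 : 0 <= L.
  have := le_trans (mdist_ge0 _ _) (fL (const_mx 1) 0).
  rewrite subr0 pmulr_lge0// sqrtr_gt0.
  under eq_bigr do rewrite mxE expr1n.
  by rewrite sumr_const card_ord.
pose D x y := mdist (f x) (f y) / (L * n%:R).
(* If [L] vanishes, so do the distances, and [D] is 0 because of the division by 0. *)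
have fD x y : mdist (f x) (f y) = L * n%:R * D x y.
  have [L00|Lneq] := eqVneq L 0; last by rewrite /D mulrC divfK// mulf_neq0// gt_eqF.
  apply/eqP; rewrite L00 !mul0r eq_le mdist_ge0 andbT.
  by have := fL x y; rewrite L00 mul0r.
have sD : short_pseudometric D.
  have Ln0 : 0 <= (L * n%:R)^-1 by rewrite invr_ge0 mulr_ge0.
  split=> [x y|x y|x y z|x y]; rewrite /D.
  - by rewrite mulr_ge0 ?mdist_ge0.
  - by rewrite metric_sym.
  - by rewrite -mulrDl ler_wpM2r// metric_triangle.
  - have [L00|Lneq] := eqVneq L 0; first by rewrite L00 mul0r invr0 mulr0.
    have Lp : 0 < L * n%:R by rewrite mulr_gt0// lt_neqAle eq_sym Lneq.
    rewrite ler_pdivrMr//; apply: le_trans (fL x y) _.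
    by rewrite [leRHS]mulrC -mulrA ler_wpM2l// enorm_le.
apply: ge_ereal_sup => _ [A [finA AS] <-]; rewrite fsbig_finite//=.
set X := fset_set A.
have AX Q : Q \in finmap.enum_fset X -> A Q.
  by rewrite (in_fset_set finA) => /set_mem.
have [code codeP] : exists code : cube R n -> nat * 'rV[int]_n, forall Q, A Q ->
    [/\ side Q = 2 ^ (k0 - (code Q).1%:Z), corner Q = corner Q0 + side Q *: emb R (code Q).2 &
        forall i, 0 <= (code Q).2 0 i < (2 ^ (code Q).1)%N].
  have [|code codeP] := @choice _ _ (fun Q (c : nat * 'rV[int]_n) => A Q ->
    [/\ side Q = 2 ^ (k0 - c.1%:Z), corner Q = corner Q0 + side Q *: emb R c.2 &
        forall i, 0 <= c.2 0 i < (2 ^ c.1)%N]); last by exists code.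
  move=> Q; have [AQ|nAQ] := pselect (A Q); last by exists (0%N, 0).
  by have [dQ _] := AS Q AQ; have [d [a da]] := coords Q dQ; exists (d, a).
(* The lattice has mesh [h = side Q0 / 2 ^ J]; the finite family decides how fine. *)
pose J := (l0 + \max_(Q <- finmap.enum_fset X) (code Q).1)%N.
pose lev Q := (J - (code Q).1)%N; pose h : R := 2 ^ (k0 - J%:Z).
have h0 : 0 < h by exact: p2.
have dJ Q : Q \in finmap.enum_fset X -> (l0 + (code Q).1 <= J)%N.
  by move=> QX; rewrite leq_add2l (leq_bigmax_seq (F := fun Q => (code Q).1)).
have sideE Q : Q \in finmap.enum_fset X -> side Q = h * 2 ^+ lev Q.
  move=> QX; have [-> _ _] := codeP Q (AX _ QX); have := dJ Q QX => QJ.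
  rewrite /h exprnP -expfzDr//; congr (_ ^ _); rewrite /lev; lia.
have sQ0E : side Q0 = h * 2 ^+ J.
  by rewrite sQ0 /h exprnP -expfzDr// subrK.
have main : \sum_(Q <- finmap.enum_fset X) (2 ^+ lev Q) ^+ n <= C * (2 ^+ J) ^+ n.
  apply: (packing (rescale (corner Q0) h D) J _ _ lev (fun Q => (code Q).2)).
  - exact: short_rescale.
  - exact: finmap.fset_uniq.
  - move=> Q Q' QX QX' [el ei].
    have sE : side Q = side Q' by rewrite !sideE// el.
    have [_ c1 _] := codeP Q (AX _ QX); have [_ c2 _] := codeP Q' (AX _ QX').
    have pE (P : cube R n) : P = (corner P, side P) by case: P.
    by rewrite [LHS]pE [RHS]pE c1 c2 sE ei.
  - by move=> Q QX; have := dJ Q QX; rewrite /lev; lia.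
  - move=> Q i QX; have [_ _ /(_ i)] := codeP Q (AX _ QX).
    have -> : (2 ^ J = 2 ^ (code Q).1 * 2 ^ lev Q)%N.
      by rewrite -expnD; congr (_ ^ _)%N; have := dJ Q QX; rewrite /lev; lia.
    rewrite -mulr_natr natz PoszM => /andP[a0 a1].
    by rewrite mulr_ge0//= ltr_pM2r// ltz_nat expn_gt0.
  - move=> Q QX; rewrite rescale_rescale => fl.
    have [sQ cQ _] := codeP Q (AX _ QX).
    have [_] := AS Q (AX _ QX); apply/negP; rewrite -leNgt.
    have -> : delta * L = delta / n%:R * (L * n%:R) by field; rewrite gt_eqF.
    apply: (md_triple_le (D := D)) => //; rewrite ?mulr_ge0 ?divr_gt0//.
      by rewrite sideE// mulr_gt0 ?exprn_gt0.
    move: fl; rewrite embMn scalerA natrX -sideE//.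
    by rewrite -cQ.
rewrite big_seq (eq_bigr (fun Q => (h ^+ n * (2 ^+ lev Q) ^+ n)%:E)); last first.
  by move=> Q QX; rewrite volE ?sideE// ?exprMn// mulr_ge0 ?exprn_ge0 ?ltW.
rewrite -big_seq sumEFin volE ?sQ0E ?mulr_ge0 ?exprn_ge0 ?(ltW h0)// -EFinM lee_fin.
by rewrite -mulr_sumr exprMn mulrCA ler_wpM2l ?exprn_ge0 ?(ltW h0).
Qed.
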